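(* Let $X$ be a real normed space, let $Q \subseteq X$ be a nonempty set, let $k \ge 2$ be an integer, and let $f : X \to \mathbb{R}$ be $k$ times Fréchet differentiable at a point $\bar{x} \in X$. If $\bar{x}$ is a local minimizer of $f$ over $Q$, then for any ordered collection of directions $(h_1, h_2, \ldots, h_{k-1}) \in X^{k-1}$ such that $T^kQ(\bar{x},h_1,\ldots,h_{k-1}) \neq \varnothing$ and $$\sum_{\alpha_1+2\alpha_2+\ldots+s\alpha_s=s}\frac{1}{\alpha_1!\cdots\alpha_s!}f^{(\alpha_1+\ldots+\alpha_s)}(\bar{x})[h_1]^{\alpha_1}\cdots[h_s]^{\alpha_s} = 0, \quad s=1,2,\ldots,k-1,$$ one has $$f'(\bar{x})w + \sum_{\alpha_1+2\alpha_2+\ldots+(k-1)\alpha_{k-1}=k}\frac{1}{\alpha_1!\cdots\alpha_{k-1}!}f^{(\alpha_1+\ldots+\alpha_{k-1})}(\bar{x})[h_1]^{\alpha_1}\cdots[h_{k-1}]^{\alpha_{k-1}} \ge 0$$ for all $w \in T^k_{pr}Q(\bar{x},h_1,\ldots,h_{k-1})$, and $$f'(\bar{x})w \ge 0 \quad \text{for all } w \in T^k_{\infty}Q(\bar{x},h_1,\ldots,h_{k-1}).$$ Here the sums run over all tuples of nonnegative integers $(\alpha_1,\ldots,\alpha_s)$, respectively $(\alpha_1,\ldots,\alpha_{k-1})$, satisfying the indicated equality.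
   Context: $X$ is a real normed space and $Q \subseteq X$ is nonempty. A point $\bar{x}$ is a local minimizer of $f$ over $Q$ if $\bar{x}\in Q$ and there is $\delta>0$ such that $f(\bar{x}) \le f(x)$ for all $x \in Q$ with $\|x-\bar{x}\| \le \delta$. $S(0)$ denotes the family of all sequences $(t_n)$ of positive real numbers converging to $0$; $U_X(w)$ denotes the family of all sequences $(w_n)$ in $X$ converging in norm to $w$. Let $\bar{x} \in \mathrm{cl}\,Q$, $k\ge 2$, $(h_1,\ldots,h_{k-1}) \in X^{k-1}$. - $T^k_{pr}Q(\bar{x},h_1,\ldots,h_{k-1})$ (the $k$-th order proper tangent set) is the set of $w\in X$ for which there exist $(t_n)\in S(0)$ and $(w_n)\in U_X(w)$ with $\bar{x}+t_nh_1+t_n^2h_2+\ldots+t_n^{k-1}h_{k-1}+t_n^kw_n\in Q$ for all $n$. - $T^kQ(\bar{x},h_1,\ldots,h_{k-1})$ (the extended tangent cone of $k$-th order) is the set of $w\in X$ for which there exist $(t_n),(\tau_n)\in S(0)$ and $(w_n)\in U_X(w)$ with $\bar{x}+t_nh_1+t_n^2h_2+\ldots+t_n^{k-1}h_{k-1}+t_n^{k-1}\tau_nw_n\in Q$ for all $n$. - $T^k_\infty Q(\bar{x},h_1,\ldots,h_{k-1})$ is the set of those $w \in T^kQ(\bar{x},h_1,\ldots,h_{k-1})$ for which the sequences in the preceding definition can be chosen so that additionally $t_n^{-1}\tau_n\to+\infty$. $f$ is $k$ times Fréchet differentiable at $\bar{x}$ if the Fréchet derivatives $f',\ldots,f^{(k-1)}$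 exist at every point of some neighborhood of $\bar{x}$ and $f^{(k-1)}$ is Fréchet differentiable at $\bar{x}$, with derivative $f^{(k)}(\bar{x})$. The derivative $f^{(j)}(\bar{x})$ is identified with a continuous symmetric $j$-linear map $X^j\to\mathbb{R}$. For a symmetric $j$-linear map $T$ and nonnegative integers with $\alpha_1+\ldots+\alpha_\mu=j$, $T[x_1]^{\alpha_1}\cdots[x_\mu]^{\alpha_\mu}$ denotes the value of $T$ when $\alpha_i$ of its arguments are equal to $x_i$, $i=1,\ldots,\mu$. *)

(* Defs.v *)
From HB Require Import structures.
From mathcomp Require Import all_boot all_order all_algebra.
From mathcomp Require Import all_classical all_reals all_analysis.

Set Implicit Arguments.
Unset Strict Implicit.
Unset Printing Implicit Defensive.

Import Order.TTheory GRing.Theory Num.Theory.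
Import numFieldNormedType.Exports.

Local Open Scope classical_set_scope.
Local Open Scope ring_scope.

Definition clin_pred (R : realType) (X V : normedModType R) : {pred X -> V} :=
  fun T => `[< linear T /\ continuous T >].

Lemma clin_submod_closed (R : realType) (X V : normedModType R) :
  submod_closed (@clin_pred R X V).
Proof.
split.
  apply/asboolP; split; first by move=> a x y /=; rewrite scaler0 addr0.
  by move=> x; exact: cvg_cst.
move=> a S T /asboolP[lS cS] /asboolP[lT cT]; apply/asboolP; split.
  move=> b x y; rewrite !fctE lS lT.
  by rewrite !scalerDr !scalerA (mulrC a b) addrACA.
by move=> x; apply: cvgD; [apply: cvgZ; [exact: cvg_cst|exact: cS]|exact: cT].
Qed.

HB.instance Definition _ (R : realType) (X V : normedModType R) :=
  GRing.isSubmodClosed.Build R (X -> V) (@clin_pred R X V)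
    (clin_submod_closed X V).

(* The normed space L(X, V) of continuous linear maps, with the operator norm
   (see clin_norm). *)
Record clin (R : realType) (X V : normedModType R) :=
  Clin { clin_fun :> X -> V; _ : clin_fun \in @clin_pred R X V }.

HB.instance Definition _ (R : realType) (X V : normedModType R) :=
  [isSub for @clin_fun R X V].
HB.instance Definition _ (R : realType) (X V : normedModType R) :=
  [Choice of clin X V by <:].
HB.instance Definition _ (R : realType) (X V : normedModType R) :=
  [SubChoice_isSubLmodule of clin X V by <:].

Section clin_norm.
Variables (R : realType) (X V : normedModType R).
Implicit Types T S : clin X V.

Lemma clin_linear T : linear T.
Proof. by have /asboolP[] := valP T. Qed.

Lemma clin_continuous T : continuous T.
Proof. by have /asboolP[] := valP T. Qed.

HB.instance Definition _ T :=
  GRing.isLinear.Build R X V *:%R (clin_fun T) (clin_linear T).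

Definition clin_norm T : R := sup [set `|T x| | x in [set x | `|x| <= 1]].

Lemma clin_norm_has_sup T :
  has_sup [set `|T x| | x in [set x | `|x| <= 1]].
Proof.
split; first by exists `|T 0|, 0 => //=; rewrite normr0.
have /linear_bounded_continuous/linear_boundedP/pinfty_ex_gt0 := @clin_continuous T.
case=> M M0 TM; exists M => _ [x /= x1 <-].
by rewrite (le_trans (TM x))// ler_piMr// ltW.
Qed.

Lemma clin_norm_ge T x : `|T x| <= clin_norm T * `|x|.
Proof.
have [->|x0] := eqVneq x 0; first by rewrite linear0 !normr0 mulr0.
have nx0 : 0 < `|x| by rewrite normr_gt0.
rewrite -ler_pdivrMr//.
have : `|T (`|x|^-1 *: x)| <= clin_norm T.
  apply: ub_le_sup; first by case: (clin_norm_has_sup T).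
  by exists (`|x|^-1 *: x) => //=; rewrite normrZ normfV normr_id mulVf ?gt_eqF.
by rewrite linearZ normrZ normfV normr_id mulrC.
Qed.

Lemma clin_norm_ge0 T : 0 <= clin_norm T.
Proof.
apply: le_trans (normr_ge0 (T 0)) _.
apply: ub_le_sup; first by case: (clin_norm_has_sup T).
by exists 0 => //=; rewrite normr0.
Qed.

Lemma clin_norm_le T (M : R) : 0 <= M ->
  (forall x, `|T x| <= M * `|x|) -> clin_norm T <= M.
Proof.
move=> M0 TM; apply: ge_sup; first by case: (clin_norm_has_sup T).
by move=> _ [x /= x1 <-]; rewrite (le_trans (TM x))// ler_piMr.
Qed.

Lemma clin_normD T S : clin_norm (T + S) <= clin_norm T + clin_norm S.
Proof.
apply: clin_norm_le => [|x]; first by rewrite addr_ge0// clin_norm_ge0.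
rewrite mulrDl; apply: le_trans (ler_normD _ _) _.
by rewrite lerD// clin_norm_ge.
Qed.

Lemma clin_normZ (a : R) T : clin_norm (a *: T) = `|a| * clin_norm T.
Proof.
have H b U : clin_norm (b *: U) <= `|b| * clin_norm U.
  apply: clin_norm_le => [|x]; first by rewrite mulr_ge0// clin_norm_ge0.
  by rewrite /= normrZ -mulrA ler_wpM2l// clin_norm_ge.
apply/le_anti; rewrite H /=.
have [->|a0] := eqVneq a 0; first by rewrite normr0 mul0r clin_norm_ge0.
rewrite -ler_pdivlMl ?normr_gt0// -normfV.
by have := H a^-1 (a *: T); rewrite scalerA mulVf// scale1r.
Qed.

Lemma clin_norm_eq0 T : clin_norm T = 0 -> T = 0.
Proof.
move=> T0; apply/val_inj/funext => x /=; apply/eqP.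
by rewrite -normr_le0 (le_trans (clin_norm_ge T x))// T0 mul0r.
Qed.

End clin_norm.

HB.instance Definition _ (R : realType) (X V : normedModType R) :=
  Lmodule_isNormed.Build R (clin X V)
    (@clin_normD R X V) (@clin_normZ R X V) (@clin_norm_eq0 R X V).

(* L(X, L(X, ... L(X, R))) with j copies of X: the value space of the j-th
   Frechet derivative, isometric to the continuous j-linear maps X^j -> R. *)
Fixpoint mlin (R : realType) (X : normedModType R) (j : nat) :
    normedModType R :=
  match j with
  | 0%N => R : normedModType R
  | i.+1 => clin X (mlin X i) : normedModType R
  end.

(* T(v_1, ..., v_j) = T v_1 v_2 ... v_j for v = [:: v_1; ...; v_j]; only used
   with size v = j. *)
Fixpoint mlin_app (R : realType) (X : normedModType R) (j : nat) :
    mlin X j -> seq X -> R :=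
  match j return mlin X j -> seq X -> R with
  | 0%N => fun T _ => T
  | i.+1 => fun T v =>
      mlin_app (clin_fun (T : clin X (mlin X i)) (head 0 v)) (behead v)
  end.

(* The differential is continuous at points of differentiability only; the
   value at other points is irrelevant. *)
Definition to_clin (R : realType) (X V : normedModType R) (T : X -> V) :
  clin X V := insubd 0 T.

(* frechet f j x is the j-th derivative of f at x, meaningful when f is j times
   differentiable at x. *)
Fixpoint frechet (R : realType) (X : normedModType R) (f : X -> R) (j : nat) :
    X -> mlin X j :=
  match j return X -> mlin X j with
  | 0%N => f
  | i.+1 => fun x => to_clin ('d (frechet f i) x)
  end.

Definition kdifferentiable (R : realType) (X : normedModType R) (f : X -> R)
    (k : nat) (x : X) : Prop :=
  (\forall y \near x, forall j, (j < k.-1)%N -> differentiable (frechet f j) y)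
  /\ differentiable (frechet f k.-1) x.

(* T[h_1]^(a_1) ... [h_m]^(a_m), with h_(i+1) stored as h`_i.  The order in
   which the arguments are listed is immaterial for a symmetric T; symmetry of
   the derivatives is a consequence of kdifferentiable, not a requirement. *)
Definition mlin_pow (R : realType) (X : normedModType R) (m : nat)
    (a : 'I_m -> nat) (T : mlin X (\sum_(i < m) a i)) (h : seq X) : R :=
  mlin_app T (flatten [seq nseq (a i) h`_i | i <- enum 'I_m]).
Arguments mlin_pow {R X m} a T h.

(* The sum over all tuples (a_1, ..., a_m) of nonnegative integers such that
   a_1 + 2 a_2 + ... + m a_m = s.  Such a tuple has all its entries at most s,
   hence the finite index type. *)
Definition faa_di_bruno (R : realType) (X : normedModType R) (f : X -> R)
    (x : X) (h : seq X) (m s : nat) : R :=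
  \sum_(a : {ffun 'I_m -> 'I_s.+1} | (\sum_(i < m) i.+1 * a i)%N == s)
    (\prod_(i < m) (a i)`!)%:R^-1 *
    mlin_pow (fun i => a i) (frechet f (\sum_(i < m) a i) x) h.

Definition local_minimizer (R : realType) (X : normedModType R) (f : X -> R)
    (Q : set X) (x : X) : Prop :=
  Q x /\ exists2 delta : R, 0 < delta &
    forall y, Q y -> `|y - x| <= delta -> f x <= f y.

Definition S0 (R : realType) : set (nat -> R) :=
  [set t | (forall n, 0 < t n) /\ t @ \oo --> (0 : R)].

Definition U (R : realType) (X : normedModType R) (w : X) : set (nat -> X) :=
  [set wn | wn @ \oo --> w].

(* x + t h_1 + ... + t^(k-1) h_(k-1) *)
Definition curve (R : realType) (X : normedModType R) (k : nat) (x : X)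
    (h : k.-1.-tuple X) (t : R) : X :=
  x + \sum_(i < k.-1) t ^+ i.+1 *: h`_i.

Definition Tpr (R : realType) (X : normedModType R) (k : nat) (Q : set X)
    (x : X) (h : k.-1.-tuple X) : set X :=
  [set w | exists (t : nat -> R) (wn : nat -> X),
    [/\ S0 t, U w wn & forall n, Q (curve x h (t n) + t n ^+ k *: wn n)]].
Arguments Tpr {R X} k Q x h.

Definition Text (R : realType) (X : normedModType R) (k : nat) (Q : set X)
    (x : X) (h : k.-1.-tuple X) : set X :=
  [set w | exists (t tau : nat -> R) (wn : nat -> X),
    [/\ S0 t, S0 tau, U w wn &
      forall n, Q (curve x h (t n) + (t n ^+ k.-1 * tau n) *: wn n)]].
Arguments Text {R X} k Q x h.

Definition Tinfty (R : realType) (X : normedModType R) (k : nat) (Q : set X)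
    (x : X) (h : k.-1.-tuple X) : set X :=
  [set w | exists (t tau : nat -> R) (wn : nat -> X),
    [/\ S0 t, S0 tau, U w wn,
      (forall n, Q (curve x h (t n) + (t n ^+ k.-1 * tau n) *: wn n)) &
      ((t n)^-1 * tau n) @[n --> \oo] --> +oo]].
Arguments Tinfty {R X} k Q x h.

(* Main.v *)
(* Taylor's formula with Peano remainder, followed by the multinomial expansion
   of the symmetric forms f^(j)(x) along the curve u(t) = sum_i t^i h_i, gives
     f(x + u(t) + z) = f(x) + f'(x) z + c_k t^k + o(t^k) + O(t |z|)   (|z| <= t),
   because the coefficients of t, ..., t^(k-1) vanish; c_k is the second sum of
   the theorem.  With z = t_n^(k-1) tau_n w_n, minimality of x and division by
   t_n^(k-1) tau_n yield 0 <= f'(x) w + l c_k for every limit l of t_n / tau_n.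
   The proper tangent set is the case tau = t, l = 1, and the set with
   tau_n / t_n -> +oo is the case l = 0. *)

Require Import Defs.
From HB Require Import structures.
From mathcomp Require Import all_boot all_order all_algebra.
From mathcomp Require Import all_classical all_reals all_analysis.
From mathcomp Require Import ring zify.

Set Implicit Arguments.
Unset Strict Implicit.
Unset Printing Implicit Defensive.

Import Order.TTheory GRing.Theory Num.Theory.
Import numFieldNormedType.Exports.

Local Open Scope classical_set_scope.
Local Open Scope ring_scope.

(** * Differentials: first-order bounds and restriction to lines *)

Section directional.
Variables (R : realType) (X V : normedModType R).

Lemma nearP_norm (P : X -> Prop) (x : X) :
  (\forall y \near x, P y) <->
  exists2 d : R, 0 < d & forall y, `|y - x| < d -> P y.
Proof.
split=> [/nbhs_normP[d /= d0 dP]|[d d0 dP]].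
  by exists d => // y yx; apply: dP; rewrite /= distrC.
by apply/nbhs_normP; exists d => // y /= yx; apply: dP; rewrite distrC.
Qed.

Lemma diff_bound (g : X -> V) (x : X) (e : R) : differentiable g x -> 0 < e ->
  exists2 d : R, 0 < d & forall v, `|v| < d ->
    `|g (x + v) - g x - 'd g x v| <= e * `|v|.
Proof.
move=> /diff_locallyxC dg e0.
have /eqaddoP/(_ e e0) : (fun v => g (x + v)) = (fun v => g x + 'd g x v) +o_ 0 id.
  by apply/eqaddoE/funext => v; rewrite dg.
move=> /nearP_norm[d d0 dP]; exists d => // v vd.
by have := dP v; rewrite subr0 /= !fctE opprD addrA => /(_ vd).
Qed.

Lemma is_derive_line (g : X -> V) (x v : X) (t : R) :
  differentiable g (x + t *: v) ->
  is_derive t 1 (fun s : R => g (x + s *: v)) ('d g (x + t *: v) v).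
Proof.
move=> dg.
have := @is_diff_comp _ _ _ _ (fun s : R => x + s *: v) (fun s => s *: v) g
  ('d g (x + t *: v)) t.
have d1 : is_diff t (fun s : R => x + s *: v) (fun s => s *: v).
  have := is_diffD (is_diff_cst x t) (is_diff_scalel t v).
  by rewrite add0r.
move=> /(_ d1 (differentiableP dg)) dgc.
have dc : differentiable (g \o (fun s : R => x + s *: v)) t by [].
split; first exact: diff_derivable.
by rewrite deriveE// diff_val /= scale1r.
Qed.

End directional.

(** * Symmetry of higher derivatives *)

Lemma MVT_derive (R : realType) (f df : R -> R) (b : R) : 0 < b ->
  (forall t, t \in `[0, b] -> is_derive t 1 f (df t)) ->
  exists2 c, c \in `[0, b] & f b - f 0 = df c * b.
Proof.
move=> b0 fdf.
have fd t : t \in `]0, b[ -> is_derive t 1 f (df t).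
  by move=> /subset_itv_oo_cc; exact: fdf.
have [|c cb ->] := MVT_segment (ltW b0) fd; last by exists c; rewrite ?subr0.
by apply: derivable_within_continuous => t /fdf[].
Qed.

Section second_difference.
Variables (R : realType) (X : normedModType R).
Implicit Types (g p q : X -> R) (x u v : X).

Definition difference2 g x u v (s : R) :=
  g (x + s *: u + s *: v) - g (x + s *: u) - g (x + s *: v) + g x.

Lemma difference2C g x u v s : difference2 g x u v s = difference2 g x v u s.
Proof. by rewrite /difference2 (addrAC x) -!addrA; congr (_ + _); rewrite addrCA. Qed.

(** The second difference is the increment over [0, [s]] of t |-> g(x + s v + t u) - g(x + t u). The
    mean value theorem turns it into a difference of two values of [p], and each is expanded at [x];
    hence differentiability of [p] at the single point [x] is enough. *)
Lemma difference2_approx g p x u v (e : R) :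
  (\forall y \near x, differentiable g y /\ 'd g y u = p y) ->
  differentiable p x -> 0 < e ->
  exists2 d : R, 0 < d & forall s : R, 0 < s < d ->
    `|difference2 g x u v s - s ^+ 2 * 'd p x v| <= e * s ^+ 2.
Proof.
move=> /nearP_norm[d1 d10 gp] dp e0.
set c := `|u| + `|v| + 1.
have c0 : 0 < c by rewrite ltr_wpDl// addr_ge0.
(* Two errors, each at most [e / (c *+ 2)] times [s * c], add up to [e * s]; the mean value theorem
   supplies the other factor [s]. *)
have e'0 : 0 < e / (c *+ 2) by rewrite divr_gt0// mulrn_wgt0.
have [d2 d20 pd] := diff_bound dp e'0.
exists (Num.min d1 d2 / c); first by rewrite divr_gt0// lt_min d10.
move=> s /andP[s0]; rewrite ltr_pdivlMr// lt_min => /andP[sd1 sd2].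
(* The boolean switches the shift by [s *: v] on or off, so that one computation serves both
   lines. *)
have norm_lt (t : R) (b : bool) : t \in `[0, s] ->
    `|t *: u + (s *+ b) *: v| <= s * (`|u| + `|v|).
  rewrite in_itv/= => /andP[t0 ts]; rewrite (le_trans (ler_normD _ _))//.
  rewrite mulrDr !normrZ (ger0_norm t0) lerD ?ler_wpM2r//.
  by case: b; rewrite ?normr0 ?gtr0_norm// ltW.
have lt_c : s * (`|u| + `|v|) < s * c by rewrite ltr_pM2l// ltrDl.
pose G b (t : R) : R := g (x + (s *+ (b : bool)) *: v + t *: u).
pose G' b (t : R) : R := p (x + (t *: u + (s *+ (b : bool)) *: v)).
have ds (t : R) (b : bool) : t \in `[0, s] -> is_derive t 1 (G b) (G' b t).
  move=> ts; rewrite /G /G'; have [] := gp (x + (s *+ b) *: v + t *: u).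
    rewrite addrAC (addrAC x) subrr add0r addrC (le_lt_trans (norm_lt t b ts))//.
    exact: lt_trans lt_c sd1.
  have -> : x + (t *: u + (s *+ b) *: v) = x + (s *+ b) *: v + t *: u.
    by rewrite [_ *: u + _]addrC addrA.
  by move=> dg <-; exact: (@is_derive_line _ _ _ g (x + (s *+ b) *: v)).
have [|t ts] := @MVT_derive R (fun t => G true t - G false t)
    (fun t => G' true t - G' false t) s s0.
  by move=> t ts; apply: is_deriveB; exact: ds.
rewrite /G /G' /= !mulr1n !mulr0n !scale0r !addr0 => Dt.
have -> : difference2 g x u v s = (p (x + (t *: u + s *: v)) - p (x + t *: u)) * s.
  by rewrite -Dt /difference2 (addrAC x); ring.
have b1 := pd _ (le_lt_trans (norm_lt t true ts) (lt_trans lt_c sd2)).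
have b0 := pd _ (le_lt_trans (norm_lt t false ts) (lt_trans lt_c sd2)).
rewrite mulr0n scale0r addr0 in b0.
have dE : 'd p x (t *: u + s *: v) = 'd p x (t *: u) + s *: 'd p x v.
  by rewrite linearD; congr (_ + _); rewrite linearZ.
rewrite mulr1n dE in b1.
have := norm_lt t true ts; have := norm_lt t false ts.
rewrite mulr0n scale0r addr0 mulr1n => n0 n1.
have -> : (p (x + (t *: u + s *: v)) - p (x + t *: u)) * s - s ^+ 2 * 'd p x v =
   ((p (x + (t *: u + s *: v)) - p x - ('d p x (t *: u) + s *: 'd p x v)) -
   (p (x + t *: u) - p x - 'd p x (t *: u))) * s.
  by rewrite /GRing.scale/=; ring.
rewrite normrM (gtr0_norm s0) expr2 mulrA ler_pM2r//.
apply: le_trans (ler_normB _ _) _; apply: le_trans (lerD b1 b0) _.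
rewrite -mulrDr; apply: (@le_trans _ _ (e / (c *+ 2) * (s * c *+ 2))).
  by rewrite ler_pM2l// mulr2n lerD// ltW// (le_lt_trans _ lt_c).
rewrite le_eqVlt; apply/orP; left; apply/eqP; field.
by rewrite gt_eqF.
Qed.

(** The second difference is symmetric in [u] and [v], and after division by [s ^+ 2] it is
    arbitrarily close to each of the two sides for small [s]. *)
Lemma schwarz g p q x u v :
  (\forall y \near x, [/\ differentiable g y, 'd g y u = p y & 'd g y v = q y]) ->
  differentiable p x -> differentiable q x -> 'd p x v = 'd q x u.
Proof.
move=> gpq dp dq.
apply/eqP; rewrite -subr_eq0 -normr_le0; apply/ler_addgt0Pl => e e0; rewrite addr0.
have e20 : 0 < e / 2 by rewrite divr_gt0.
have [|d1 d10 h1] := @difference2_approx g p x u v _ _ dp e20.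
  by apply: filterS gpq => y [].
have [|d2 d20 h2] := @difference2_approx g q x v u _ _ dq e20.
  by apply: filterS gpq => y [].
set s := Num.min d1 d2 / 2.
have s0 : 0 < s by rewrite divr_gt0// lt_min d10.
have [sd1 sd2] : s < d1 /\ s < d2.
  by split; rewrite ltr_pdivrMr// gt_min; apply/orP;
    [left|right]; rewrite ltr_pMr// ltr1n.
have := h1 s; have := h2 s; rewrite s0 sd1 sd2 => /(_ isT) b2 /(_ isT) b1.
rewrite difference2C in b2.
rewrite -(@ler_pM2r _ (s ^+ 2)) ?exprn_gt0//.
rewrite -[X in _ * X <= _]ger0_norm ?sqr_ge0// -normrM.
set D := difference2 _ _ _ _ _ in b1 b2.
rewrite (_ : _ * _ = (D - s ^+ 2 * 'd q x u) - (D - s ^+ 2 * 'd p x v)); last by ring.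
by rewrite [e]splitr mulrDl (le_trans (ler_normB _ _))// lerD.
Qed.

End second_difference.

Section multilinear_forms.
Variables (R : realType) (X : normedModType R).

Lemma mlin_app_linearl (j : nat) (s : seq X) (a : R) (T S : mlin X j) :
  mlin_app (a *: T + S) s = a * mlin_app T s + mlin_app S s.
Proof. by elim: j s T S => [|j IHj] s T S //=; rewrite IHj. Qed.

Lemma mlin_app0l (j : nat) (s : seq X) : mlin_app (0 : mlin X j) s = 0.
Proof. by elim: j s => [|j IHj] s //=. Qed.

Lemma mlin_appZl (j : nat) (s : seq X) (a : R) (T : mlin X j) :
  mlin_app (a *: T) s = a * mlin_app T s.
Proof. by rewrite -[a *: T]addr0 mlin_app_linearl mlin_app0l addr0. Qed.

Lemma mlin_appBl (j : nat) (s : seq X) (T S : mlin X j) :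
  mlin_app (T - S) s = mlin_app T s - mlin_app S s.
Proof. by rewrite addrC -scaleN1r mlin_app_linearl mulN1r addrC. Qed.

Lemma mlin_app_linear_head (j : nat) (T : mlin X j.+1) (a : R) (u v : X) (s : seq X) :
  mlin_app T (a *: u + v :: s) = a * mlin_app T (u :: s) + mlin_app T (v :: s).
Proof. by rewrite /= linearP mlin_app_linearl. Qed.

Lemma mlin_app_bound (j : nat) (T : mlin X j) (s : seq X) : size s = j ->
  `|mlin_app T s| <= `|T| * \prod_(v <- s) `|v|.
Proof.
elim: j T s => [|j IHj] T [|v s]//=; first by rewrite big_nil mulr1.
move=> [ss]; rewrite big_cons mulrA; apply: le_trans (IHj _ _ ss) _.
by apply: ler_wpM2r (clin_norm_ge T v); apply: prodr_ge0.
Qed.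

Lemma mlin_app_continuous (j : nat) (s : seq X) : size s = j ->
  continuous (fun T : mlin X j => mlin_app T s).
Proof.
move=> ss T; apply/cvgrPdist_le => e e0.
set c := \prod_(v <- s) `|v| + 1.
have c0 : 0 < c by rewrite ltr_wpDl// prodr_ge0.
apply/nearP_norm; exists (e / c) => [|S ST]; first by rewrite divr_gt0.
have -> : mlin_app T s - mlin_app S s = mlin_app ((-1) *: S + T) s.
  by rewrite mlin_app_linearl mulN1r addrC.
rewrite (le_trans (mlin_app_bound _ ss))//; rewrite scaleN1r addrC distrC.
rewrite ltr_pdivlMr// in ST; apply: le_trans (ltW ST).
by rewrite ler_wpM2l// lerDl.
Qed.

Variable f : X -> R.

Lemma frechetS (j : nat) (y v : X) : differentiable (frechet f j) y ->
  clin_fun (frechet f j.+1 y) v = 'd (frechet f j) y v.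
Proof.
move=> df /=; rewrite /to_clin insubdK//.
by apply/asboolP; split; [exact: linearP|exact: diff_continuous].
Qed.

(** Evaluation at a fixed [s] is linear and continuous on [mlin X j], so the chain rule applies; the
    new direction enters as the first argument. *)
Lemma frechet_app_diff (j : nat) (y : X) (s : seq X) : size s = j ->
  differentiable (frechet f j) y ->
  is_diff y (fun z => mlin_app (frechet f j z) s)
            (fun v => mlin_app (frechet f j.+1 y) (v :: s)).
Proof.
move=> ss df.
pose L : {linear mlin X j -> R} := HB.pack (fun T : mlin X j => mlin_app T s)
  (GRing.isLinear.Build R (mlin X j) R _ _ (@mlin_app_linearl j s)).
have dL : is_diff (frechet f j y) L L.
  have cL : continuous L by exact: mlin_app_continuous.
  by split; [exact: linear_differentiable|exact: diff_lin].
have := is_diff_comp (differentiableP df) dL.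
move/is_diff_eq; apply; apply/funext => v /=.
by rewrite -/(frechet f j.+1 y) -(frechetS _ df).
Qed.

End multilinear_forms.

(** Permutations of the tail and the exchange of the first two entries generate all permutations:
    the head [b] of the target is brought to second place, exchanged with [a], and the tail is then
    rearranged. *)
Lemma perm_invariant_cons (T : eqType) (Y : Type) (F : seq T -> Y) (n : nat) :
  (forall a s s', size s = n.+1 -> perm_eq s s' -> F (a :: s) = F (a :: s')) ->
  (forall a b s, size s = n -> F [:: a, b & s] = F [:: b, a & s]) ->
  forall s s', size s = n.+2 -> perm_eq s s' -> F s = F s'.
Proof.
move=> Ftail Fswap [|a s]//= [|b s']; first by move=> _ /perm_nilP.
move=> [ss] ps; have [ab|ab] := eqVneq a b.
  by move: ps; rewrite -ab perm_cons; exact: Ftail.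
have bs : b \in s.
  by have := perm_mem ps b; rewrite !inE eqxx eq_sym (negPf ab).
have pq := perm_to_rem bs; have sq : size (rem b s) = n by rewrite size_rem// ss.
rewrite (Ftail a _ _ ss pq) Fswap//; apply: Ftail; first by rewrite /= sq.
rewrite -(perm_cons b); apply: perm_trans ps.
apply: (@perm_trans _ [:: a, b & rem b s]).
  by apply/permPl; exact: (perm_catCA [:: b] [:: a]).
by rewrite perm_cons perm_sym.
Qed.

Section symmetry.
Variables (R : realType) (X : normedModType R) (f : X -> R).

Lemma kdifferentiable_near (k : nat) (x : X) : kdifferentiable f k x ->
  \forall y \near x, forall j, (0 < j < k)%N -> kdifferentiable f j y.
Proof.
move=> [/nbhs_interior fx _]; apply: filterS fx => y fy j jk.
have fyy := nbhs_singleton fy; split.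
  apply: filterS fy => z fz i ij; apply: fz; lia.
apply: fyy; lia.
Qed.

(** Induction on the order. Symmetry of the preceding derivative holds near [x], and differentiating
    it permits permutations of the tail; [schwarz], applied to the derivative two orders below
    evaluated at the remaining arguments, exchanges the first two. *)
Lemma frechet_sym (j : nat) (x : X) (s s' : seq X) : kdifferentiable f j x ->
  size s = j -> perm_eq s s' ->
  mlin_app (frechet f j x) s = mlin_app (frechet f j x) s'.
Proof.
elim/ltn_ind: j x s s' => -[|[|j]] IH x s s'.
- by case: s => // _ _; rewrite perm_sym => /perm_nilP ->.
- by case: s => [|a [|]]// _ _; rewrite perm_sym => /perm_small_eq ->.
move=> kf; have nf := kdifferentiable_near kf; case: kf => [df dfx].
apply: perm_invariant_cons => [a r r' rj prr'|a b r rj].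
  have /= dr := @diff_val _ _ _ _ _ _ _ (frechet_app_diff rj dfx).
  have r'j : size r' = j.+1 by rewrite -rj (perm_size prr').
  have /= dr' := @diff_val _ _ _ _ _ _ _ (frechet_app_diff r'j dfx).
  have := congr1 (fun g => g a) dr; have := congr1 (fun g => g a) dr' => /= <- <-.
  have D q : size q = j.+1 ->
      differentiable (fun z => mlin_app (frechet f j.+1 z) q) x.
    by move=> qj; have [] := frechet_app_diff qj dfx.
  (* [near_eq_derive] asks for a nonzero direction, so [a = 0] is settled by linearity. *)
  have [->|a0] := eqVneq a 0; first by rewrite !linear0.
  rewrite -!deriveE//; [|exact: D..].
  apply: near_eq_derive => //; apply: filterS nf => y fy.
  by apply: (IH j.+1) => //; apply: fy; rewrite /= ltnSn.
have D c : size (c :: r) = j.+1 by rewrite /= rj.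
have [da ea] := frechet_app_diff (D a) dfx.
have [db eb] := frechet_app_diff (D b) dfx.
rewrite -[LHS](congr1 (fun g => g a) eb) -[RHS](congr1 (fun g => g b) ea).
apply: (@schwarz _ _ (fun y => mlin_app (frechet f j y) r)) => //.
by apply: filterS df => y /(_ j (ltnSn _))/(frechet_app_diff rj)[? /= ->].
Qed.

End symmetry.

(** * Taylor's formula *)

(** A bound [M] for [F j.+1] on [0, 1] passes down to [F j], which vanishes at 0, because the
    intervals have length at most 1. *)
Lemma iterated_MVT_bound (R : realType) (n : nat) (F : nat -> R -> R) (M : R) :
  (forall j (t : R), (j < n)%N -> t \in `[0, 1] -> is_derive t 1 (F j) (F j.+1 t)) ->
  (forall j, (j < n)%N -> F j 0 = 0) ->
  (forall t : R, t \in `[0, 1] -> `|F n t| <= M) ->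
  forall t : R, t \in `[0, 1] -> `|F 0%N t| <= M.
Proof.
elim: n F => [//|n IHn] F dF F0 FM t t01.
have F1 := IHn (fun j => F j.+1) (fun j t jn => dF j.+1 t jn) (fun j jn => F0 j.+1 jn) FM.
move: (t01); rewrite in_itv/= => /andP[t0 t1].
have [tn|tn] := leP t 0.
  by rewrite (le_anti (introT andP (conj tn t0))) F0// normr0 (le_trans _ (F1 t t01)).
have dF0 s : s \in `[0, t] -> is_derive s 1 (F 0%N) (F 1%N s).
  rewrite in_itv/= => /andP[s0 st]; apply: dF => //.
  by rewrite in_itv/= s0 (le_trans st).
have [c] := MVT_derive tn dF0.
rewrite in_itv/= F0// subr0 => /andP[c0 ct] ->; rewrite normrM (gtr0_norm tn).
have c01 : c \in `[0, 1] by rewrite in_itv/= c0 (le_trans ct).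
by rewrite (le_trans _ (F1 c c01))// ler_piMr.
Qed.

Section taylor.
Variables (R : realType) (X : normedModType R) (f : X -> R).

(* The remainder along t |-> x + t v and its first k - 1 derivatives vanish at 0;
   the (k-1)-st is |v|^(k-1) times the error o(|v|) in differentiating f^(k-1). *)
Lemma taylor_peano (k : nat) (x : X) (e : R) : (0 < k)%N ->
  kdifferentiable f k x -> 0 < e ->
  exists2 d : R, 0 < d & forall v, `|v| < d ->
    `|f (x + v) - \sum_(j < k.+1) j`!%:R^-1 * mlin_app (frechet f j x) (nseq j v)|
      <= e * `|v| ^+ k.
Proof.
case: k => // n _ [/nearP_norm[d1 d10 df] dfx] e0.
have [d2 d20 tf] := diff_bound dfx e0.
exists (Num.min d1 d2) => [|v]; first by rewrite lt_min d10.
rewrite lt_min => /andP[vd1 vd2].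
pose c i := mlin_app (frechet f i x) (nseq i v).
pose P : {poly R} := \poly_(i < n.+2) (i`!%:R^-1 * c i).
pose F j t := mlin_app (frechet f j (x + t *: v)) (nseq j v) - (P^`(j)).[t].
have tv (t : R) : t \in `[0, 1] -> `|t *: v| <= `|v|.
  by rewrite in_itv/= => /andP[t0 t1]; rewrite normrZ ger0_norm// ler_piMl.
have cP j i : (i + j < n.+2)%N -> (P^`(j))`_i = i`!%:R^-1 * c (j + i)%N.
  (* The falling factorial produced by [j] differentiations reduces 1/(i+j)! to 1/i!. *)
  move=> ij; rewrite coef_derivn coef_poly addnC ij -mulrnAl -[_ *+ _]mulr_natr.
  congr (_ * _); rewrite -(ffact_fact (leq_addl i j)) addnK natrM invfM mulrC mulrA.
  by rewrite divff ?mul1r// pnatr_eq0 -lt0n ffact_gt0 leq_addl.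
have Fd j (t : R) : (j < n)%N -> t \in `[0, 1] -> is_derive t 1 (F j) (F j.+1 t).
  move=> jn t01; rewrite /F derivnS; apply: is_deriveB.
  have [] := frechet_app_diff (size_nseq j v) (df (x + t *: v) _ j jn).
    by rewrite addrC addKr (le_lt_trans (tv t t01)).
  by move=> dj ej; have := is_derive_line dj; rewrite ej.
have F0 j : (j < n)%N -> F j 0 = 0.
  move=> jn; rewrite /F scale0r addr0 horner_coef0 cP ?add0n 1?ltnW 1?ltnW//.
  by rewrite fact0 invr1 mul1r addn0 subrr.
have Fn (t : R) : t \in `[0, 1] -> `|F n t| <= e * `|v| ^+ n.+1.
  move=> t01.
  have Pn : (P^`(n)).[t] = c n + t * c n.+1.
    rewrite (@horner_coef_wide _ 2); last first.
      apply/leq_sizeP => j j2; rewrite coef_derivn coef_poly ifN ?mul0rn//; lia.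
    rewrite big_ord_recl big_ord1/= !cP// ?addn0 ?addn1 1?ltnW// !fact0.
    by rewrite invr1 !mul1r expr0 expr1 mulr1 mulrC.
  have -> : F n t = mlin_app
      (frechet f n (x + t *: v) - frechet f n x - 'd (frechet f n) x (t *: v)) (nseq n v).
    rewrite 2!mlin_appBl linearZ mlin_appZl -(frechetS _ dfx).
    by rewrite /F Pn opprD addrA.
  apply: le_trans (mlin_app_bound _ (size_nseq n v)) _.
  rewrite big_nseq iter_mulr_1 exprS mulrA ler_wpM2r ?exprn_ge0//.
  by rewrite (le_trans (tf _ (le_lt_trans (tv t t01) vd2)))// ler_pM2l// tv.
have F01 := iterated_MVT_bound Fd F0 Fn.
have := F01 1; rewrite in_itv/= ler01 lexx => /(_ isT); rewrite /F scale1r.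
congr (`|_ - _| <= _).
rewrite derivn0 horner_poly; apply: eq_bigr => i _.
by rewrite expr1n mulr1.
Qed.

End taylor.

(** * Multinomial expansion of symmetric multilinear families *)

Section finite_function_cons.
Variables (T : finType) (m : nat).

Definition ffun_cons (b : T) (a : {ffun 'I_m -> T}) : {ffun 'I_m.+1 -> T} :=
  [ffun i => if unlift ord0 i is Some j then a j else b].

Lemma ffun_cons0 b a : ffun_cons b a ord0 = b.
Proof. by rewrite ffunE unlift_none. Qed.

Lemma ffun_consS b a i : ffun_cons b a (lift ord0 i) = a i.
Proof. by rewrite ffunE liftK. Qed.

Lemma sum_ffun_cons (V : nmodType) (F : {ffun 'I_m.+1 -> T} -> V) :
  \sum_a F a = \sum_b \sum_a F (ffun_cons b a).
Proof.
rewrite pair_big (reindex (fun p => ffun_cons p.1 p.2))//=.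
exists (fun a => (a ord0, [ffun i => a (lift ord0 i)])) => [[b a] _|a _] /=.
  by rewrite ffun_cons0; congr pair; apply/ffunP => i; rewrite !ffunE liftK.
apply/ffunP => i; rewrite ffunE; case: unliftP => [j ->|-> //].
by rewrite ffunE.
Qed.

End finite_function_cons.

Section symmetric_multilinear.
Variables (R : realType) (X : normedModType R).
Implicit Types (A : seq X -> R) (s r : seq X) (y z : nat -> X).

(** Linearity is asked of the first argument only, since symmetry carries it to the others. [A]
    gathers one form for each length, with no relation between different lengths. *)
Definition symmetric_multilinear A :=
  (forall s s', perm_eq s s' -> A s = A s') /\
  (forall a u v s, A (a *: u + v :: s) = a * A (u :: s) + A (v :: s)).

(** The argument list of [mlin_pow], with directions given by a function on [nat] so that they can
    be shifted and rescaled. *)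
Definition arguments (m : nat) (a : 'I_m -> nat) y : seq X :=
  flatten [seq nseq (a i) (y i) | i <- enum 'I_m].

Variable A : seq X -> R.
Hypothesis Aml : symmetric_multilinear A.

Lemma sml_perm s s' : perm_eq s s' -> A s = A s'.
Proof. by case: Aml => + _; apply. Qed.

Lemma sml_catC s s' r : A (s ++ s' ++ r) = A (s' ++ s ++ r).
Proof. by apply: sml_perm; apply/permPl; exact: perm_catCA. Qed.

Lemma smlD u v s : A (u + v :: s) = A (u :: s) + A (v :: s).
Proof. by case: Aml => _ Al; rewrite -[u]scale1r Al !scale1r mul1r. Qed.

Lemma sml0 s : A (0 :: s) = 0.
Proof. by apply: (@addrI _ (A (0 :: s))); rewrite -smlD !addr0. Qed.

Lemma smlZ a u s : A (a *: u :: s) = a * A (u :: s).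
Proof. by case: Aml => _ Al; rewrite -[a *: u]addr0 Al sml0 addr0. Qed.

Lemma sml_consC u s r : A (u :: s ++ r) = A (s ++ u :: r).
Proof. exact: (sml_catC [:: u]). Qed.

Lemma sml_nseqZ n a u s : A (nseq n (a *: u) ++ s) = a ^+ n * A (nseq n u ++ s).
Proof.
elim: n s => [|n IHn] s /=; first by rewrite mul1r.
by rewrite smlZ 2!sml_consC IHn mulrA exprS.
Qed.

Lemma sml_flattenZ (I : Type) (l : seq I) (a : I -> nat) (c : I -> R) (z : I -> X) r :
  A (flatten [seq nseq (a i) (c i *: z i) | i <- l] ++ r) =
  (\prod_(i <- l) c i ^+ a i) * A (flatten [seq nseq (a i) (z i) | i <- l] ++ r).
Proof.
elim: l r => [|i l IHl] r; first by rewrite big_nil mul1r.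
rewrite /= big_cons -!catA sml_nseqZ.
rewrite (sml_catC _ (flatten [seq nseq (a j) (c j *: z j) | j <- l])) IHl mulrA.
by congr (_ * _); exact: sml_catC.
Qed.

(* Both sides satisfy the recursion (n+1) E_(n+1)(r) = E_n(u :: r) + E_n(v :: r). *)
Lemma sml_binomial n u v r :
  n`!%:R^-1 * A (nseq n (u + v) ++ r) =
  \sum_(b < n.+1) b`!%:R^-1 * (n - b)`!%:R^-1 * A (nseq b u ++ nseq (n - b) v ++ r).
Proof.
elim: n r => [|n IHn] r; first by rewrite big_ord1 /= fact0 invr1 !mul1r.
have n0 : n.+1%:R != 0 :> R by rewrite pnatr_eq0.
have fS i : (i.+1)`!%:R^-1 = i.+1%:R^-1 * i`!%:R^-1 :> R.
  by rewrite factS natrM invfM.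
apply: (mulfI n0); rewrite fS !mulrA divff// mul1r /= smlD mulrDr.
rewrite 2!sml_consC !IHn mulr_sumr.
transitivity (\sum_(b < n.+2) (b%:R *
    (b`!%:R^-1 * (n.+1 - b)`!%:R^-1 * A (nseq b u ++ nseq (n.+1 - b) v ++ r)) +
  (n.+1 - b)%:R *
    (b`!%:R^-1 * (n.+1 - b)`!%:R^-1 * A (nseq b u ++ nseq (n.+1 - b) v ++ r)))).
  rewrite big_split /=; congr (_ + _).
    rewrite [RHS]big_ord_recl mul0r add0r; apply: eq_bigr => b _.
    rewrite lift0 subSS fS !mulrA divff ?pnatr_eq0// mul1r /=.
    by rewrite !catA sml_consC.
  rewrite [RHS]big_ord_recr /= subnn mul0r addr0; apply: eq_bigr => b _.
  rewrite subSn ?leq_ord// fS (mulrCA _ _ (n - b)`!%:R^-1).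
  rewrite !mulrA divff ?pnatr_eq0// mul1r /=.
  by rewrite -[in RHS]sml_consC !catA sml_consC.
by apply: eq_bigr => b _; rewrite -mulrDl -natrD subnKC// -ltnS ltn_ord.
Qed.

Lemma arguments_cons m (a : 'I_m.+1 -> nat) y :
  arguments a y = nseq (a ord0) (y 0%N) ++
    arguments (fun i => a (lift ord0 i)) (fun i => y i.+1).
Proof. by rewrite /arguments enum_ordSl /= -map_comp. Qed.

Lemma sml_multinomial K m n y r : (n <= K)%N ->
  n`!%:R^-1 * A (nseq n (\sum_(i < m) y i) ++ r) =
  \sum_(a : {ffun 'I_m -> 'I_K.+1} | (\sum_(i < m) a i)%N == n)
    (\prod_(i < m) (a i)`!)%:R^-1 * A (arguments (fun i => a i) y ++ r).
Proof.
elim: m n y r => [|m IHm] n y r nK.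
  rewrite big_ord0.
  (* For [m = 0] the only tuple is empty, of sum 0; when [n > 0] the left side has a zero argument
     and vanishes. *)
  have e0 : all_equal_to ([ffun=> ord0] : {ffun 'I_0 -> 'I_K.+1}).
    by move=> a; apply/ffunP => -[].
  rewrite big_mkcond (big_pred1 [ffun=> ord0]); last by move=> a; rewrite [a]e0 /= eqxx.
  rewrite !big_ord0 /arguments enum_ord0 /= invr1 mul1r eq_sym.
  by case: n nK => [_|n _] /=; rewrite ?invr1 ?mul1r// sml0 mulr0.
rewrite big_ord_recl sml_binomial.
transitivity (\sum_(b < n.+1) \sum_(a : {ffun 'I_m -> 'I_K.+1} |
     (\sum_(i < m) a i)%N == (n - b)%N)
   b`!%:R^-1 * (\prod_(i < m) (a i)`!)%:R^-1 *
   A (arguments (fun i => a i) (fun i => y i.+1) ++ nseq b (y 0%N) ++ r)).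
  apply: eq_bigr => b _; rewrite -mulrA sml_catC.
  under [X in nseq _ X]eq_bigr do rewrite lift0.
  rewrite (IHm _ (fun i => y i.+1)) ?(leq_trans (leq_subr _ _))//.
  by rewrite mulr_sumr; apply: eq_bigr => a _; rewrite mulrA.
(* The range of [b] grows from [n.+1] to [K.+1]; the added values exceed [n] and admit no tuple of
   sum [n]. *)
rewrite [RHS]big_mkcond sum_ffun_cons (big_ord_widen_cond K.+1 xpredT (fun b =>
  \sum_(a : {ffun 'I_m -> 'I_K.+1} | (\sum_(i < m) a i)%N == (n - b)%N)
   b`!%:R^-1 * (\prod_(i < m) (a i)`!)%:R^-1 *
   A (arguments (fun i => a i) (fun i => y i.+1) ++ nseq b (y 0%N) ++ r)))//.
rewrite [LHS]big_mkcond; apply: eq_bigr => b _.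
have eb : forall a : {ffun 'I_m -> 'I_K.+1},
  ((\sum_(i < m.+1) ffun_cons b a i)%N == n) =
  (b < n.+1)%N && ((\sum_(i < m) a i)%N == (n - b)%N).
  move=> a; rewrite big_ord_recl ffun_cons0.
  under eq_bigr do rewrite ffun_consS.
  move: (\sum_(i < m) a i)%N => S; rewrite -[LHS]/((b + S)%N == n); lia.
case: ifPn => /= bn; last first.
  by rewrite big1// => a _; rewrite eb (negPf bn).
rewrite big_mkcond; apply: eq_bigr => a _; rewrite eb bn /=; case: ifP => // _.
rewrite big_ord_recl ffun_cons0 natrM invfM arguments_cons ffun_cons0 -catA sml_catC.
congr (_ * _ * A (_ ++ _)).
  by congr (_ %:R^-1); apply: eq_bigr => i _; rewrite ffun_consS.
by congr (flatten _ ++ r); apply: eq_map => i; rewrite ffun_consS.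
Qed.

End symmetric_multilinear.

Lemma sum_fibers (V : nmodType) (I : finType) (w : I -> nat) (n : nat) (F : I -> V) :
  \sum_(i | (w i < n)%N) F i = \sum_(j < n) \sum_(i | w i == j) F i.
Proof.
rewrite (exchange_big_dep (fun i => (w i < n)%N))/=; last by move=> j i _ /eqP ->.
apply: eq_bigr => i wi; rewrite (big_pred1 (Ordinal wi))//.
Qed.

(** * Coefficients graded by powers of the curve parameter *)

Section graded_coefficients.
Variables (R : realType) (X : normedModType R) (A : seq X -> R) (y : nat -> X).

Definition weight (m : nat) (a : 'I_m -> nat) := (\sum_(i < m) i.+1 * a i)%N.

Definition taylor_term (m : nat) (a : 'I_m -> nat) : R :=
  (\prod_(i < m) (a i)`!)%:R^-1 * A (arguments a y).

(** The coefficient of t^s in the expansion along t y_0 + t^2 y_1 + ... The entry bound [B] is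
    separate from [s]: the expansion uses one bound for all weights, [faa_di_bruno] uses [s]
    itself. *)
Definition graded_coef (m B s : nat) : R :=
  \sum_(a : {ffun 'I_m -> 'I_B.+1} | weight (fun i => a i) == s)
    taylor_term (fun i => a i).

(** Padding by zeros makes tuples over different index types comparable. *)
Definition extend0 (m B : nat) (a : {ffun 'I_m -> 'I_B.+1}) (i : nat) : nat :=
  if insub i is Some j then a j else 0%N.

Lemma extend0_ord m B (a : {ffun 'I_m -> 'I_B.+1}) (i : 'I_m) :
  extend0 a i = a i.
Proof. by rewrite /extend0 valK. Qed.

Lemma extend0_ge m B (a : {ffun 'I_m -> 'I_B.+1}) i : (m <= i)%N -> extend0 a i = 0%N.
Proof. by move=> mi; rewrite /extend0 insubF// ltnNge mi. Qed.

Lemma extend0_inj m B (a b : {ffun 'I_m -> 'I_B.+1}) :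
  extend0 a =1 extend0 b -> a = b.
Proof. by move=> ab; apply/ffunP => i; apply/val_inj; rewrite /= -!extend0_ord ab. Qed.

Lemma weight_extend0 m B (a : {ffun 'I_m -> 'I_B.+1}) N : (m <= N)%N ->
  weight (fun i => a i) = weight (fun i : 'I_N => extend0 a i).
Proof.
move=> mN; rewrite /weight (eq_bigr (fun i : 'I_m => i.+1 * extend0 a i)%N); last first.
  by move=> i _; rewrite extend0_ord.
rewrite (big_ord_widen N (fun i => i.+1 * extend0 a i)%N mN) big_mkcond.
by apply: eq_bigr => i _; case: ltnP => // /extend0_ge ->; rewrite muln0.
Qed.

Lemma taylor_term_extend0 m B (a : {ffun 'I_m -> 'I_B.+1}) N : (m <= N)%N ->
  taylor_term (fun i => a i) = taylor_term (fun i : 'I_N => extend0 a i).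
Proof.
move=> mN; congr (_%:R^-1 * A _).
  rewrite (eq_bigr (fun i : 'I_m => (extend0 a i)`!)); last first.
    by move=> i _; rewrite extend0_ord.
  rewrite (big_ord_widen N (fun i => (extend0 a i)`!) mN) big_mkcond.
  by apply: eq_bigr => i _; case: ltnP => // /extend0_ge ->.
have argE n : arguments (fun i : 'I_n => extend0 a i) y =
    flatten [seq nseq (extend0 a i) (y i) | i <- iota 0 n].
  by rewrite /arguments -val_enum_ord -map_comp.
rewrite argE -(subnKC mN) iotaD map_cat flatten_cat -argE add0n.
rewrite [X in _ ++ X](_ : _ = [::]) ?cats0; last first.
  apply/nilP; rewrite /nilp size_flatten /shape -map_comp sumnE big_map big1_seq// => i.
  by rewrite mem_iota => /andP[_ /andP[mi _]] /=; rewrite extend0_ge.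
by congr flatten; apply: eq_map => i; rewrite extend0_ord.
Qed.

Definition transfer m' B' m B (a : {ffun 'I_m -> 'I_B.+1}) : {ffun 'I_m' -> 'I_B'.+1} :=
  [ffun i => inord (extend0 a (val i))].

(** In a tuple of weight [s] every entry is at most [s], and the entries of index [i >= s] vanish
    because [i.+1 * a i <= s]. If [m' < m], the hypothesis on minima forces [s <= m'], so truncation
    loses only zeros. *)
Lemma transfer_extend0 m m' B B' (a : {ffun 'I_m -> 'I_B.+1}) s :
  (s <= B')%N -> minn m s = minn m' s -> weight (fun i => a i) = s ->
  extend0 (transfer m' B' a) =1 extend0 a.
Proof.
move=> sB' mm' was i.
have le_s (j : 'I_m) : (j.+1 * a j <= s)%N.
  by rewrite -was /weight (bigD1 j)//= leq_addr.
have ext_s : (extend0 a i <= s)%N.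
  rewrite /extend0; case: insubP => // j _ _.
  by apply: leq_trans (le_s j); rewrite leq_pmull.
have [im'|m'i] := ltnP i m'.
  by rewrite (extend0_ord _ (Ordinal im')) ffunE inordK// ltnS (leq_trans ext_s).
rewrite extend0_ge//; have [im|mi] := ltnP i m; last by rewrite extend0_ge.
rewrite (extend0_ord a (Ordinal im)).
have := le_s (Ordinal im) => /=; case: (nat_of_ord (a _)) => // c; nia.
Qed.

(** [transfer] is a bijection between the tuples of weight [s] and preserves their terms. This
    identifies a coefficient computed with [k.-1] directions with the sum over [s] directions in the
    vanishing conditions. *)
Lemma graded_coef_index m m' B B' s : (s <= B)%N -> (s <= B')%N ->
  minn m s = minn m' s -> graded_coef m B s = graded_coef m' B' s.
Proof.
move=> sB sB' mm'; rewrite /graded_coef.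
pose N := maxn m m'; have mN : (m <= N)%N := leq_maxl _ _.
have m'N : (m' <= N)%N := leq_maxr _ _.
have wE C C' (a : {ffun 'I_m -> 'I_C.+1}) (b : {ffun 'I_m' -> 'I_C'.+1}) :
    extend0 a =1 extend0 b -> weight (fun i => a i) = weight (fun i => b i).
  move=> ab; rewrite (weight_extend0 _ mN) (weight_extend0 _ m'N).
  by apply: eq_bigr => i _; rewrite ab.
have tE C C' (a : {ffun 'I_m -> 'I_C.+1}) (b : {ffun 'I_m' -> 'I_C'.+1}) :
    extend0 a =1 extend0 b ->
    taylor_term (fun i => a i) = taylor_term (fun i => b i).
  move=> ab; rewrite (taylor_term_extend0 _ mN) (taylor_term_extend0 _ m'N).
  by congr taylor_term; apply/funext => i; rewrite ab.
have tr1 (a : {ffun 'I_m -> 'I_B.+1}) : weight (fun i => a i) = s ->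
    extend0 (transfer m' B' a) =1 extend0 a by exact: transfer_extend0.
have tr2 (b : {ffun 'I_m' -> 'I_B'.+1}) : weight (fun i => b i) = s ->
    extend0 (transfer m B b) =1 extend0 b by apply: transfer_extend0.
rewrite (reindex_onto (@transfer m B m' B') (@transfer m' B' m B)); last first.
  move=> a /eqP aw; apply: extend0_inj => i.
  by rewrite tr2 ?tr1// -aw; apply/esym/wE => j; rewrite tr1.
apply: eq_big => [b|b /andP[/eqP wb /eqP bb]].
  apply/andP/eqP => [[/eqP wb /eqP bb]|wb].
    by rewrite -wb; apply/esym/wE => j; rewrite -[in RHS]bb tr1.
  have wb' : weight (fun i => transfer m B b i) = s.
    by rewrite -wb; apply: wE => j; rewrite tr2.
  by split; apply/eqP => //; apply: extend0_inj => i; rewrite tr1// tr2.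
by apply: tE => j; rewrite -[in RHS]bb tr1.
Qed.

Hypothesis Aml : symmetric_multilinear A.

Lemma graded_coef0 m B : graded_coef m B 0%N = A [::].
Proof.
rewrite (@graded_coef_index m 0%N B 0%N 0%N)//.
rewrite /graded_coef (big_pred1 [ffun=> ord0]); last first.
  move=> a /=; rewrite /weight big_ord0 eqxx; apply/esym/eqP/ffunP => -[] //.
by rewrite /taylor_term big_ord0 invr1 mul1r /arguments enum_ord0.
Qed.

Lemma taylor_term_scale m (a : 'I_m -> nat) (t : R) :
  (\prod_(i < m) (a i)`!)%:R^-1 * A (arguments a (fun i => t ^+ i.+1 *: y i)) =
  t ^+ weight a * taylor_term a.
Proof.
rewrite /arguments -[flatten _]cats0 (sml_flattenZ Aml) cats0 mulrCA.
congr (_ * _); rewrite big_enum /= /weight -prodrXr.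
by apply: eq_bigr => i _; rewrite exprM.
Qed.

(** The first sum runs over tuples of degree at most [k], the second over those of weight at most
    [k]. Since degree is at most weight, the difference keeps only tuples of weight above [k], each
    carrying at least the power t^(k+1). *)
Lemma sml_expansion k m : exists2 C : R, 0 <= C & forall t : R, 0 <= t <= 1 ->
  `|\sum_(j < k.+1) j`!%:R^-1 * A (nseq j (\sum_(i < m) t ^+ i.+1 *: y i)) -
    \sum_(s < k.+1) t ^+ s * graded_coef m k s| <= C * t ^+ k.+1.
Proof.
pose deg (a : {ffun 'I_m -> 'I_k.+1}) := (\sum_(i < m) a i)%N.
pose wt (a : {ffun 'I_m -> 'I_k.+1}) := weight (fun i => a i).
pose F (a : {ffun 'I_m -> 'I_k.+1}) := taylor_term (fun i => a i).
exists (\sum_a `|F a|) => [|t /andP[t0 t1]]; first by rewrite sumr_ge0.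
have -> : \sum_(j < k.+1) j`!%:R^-1 * A (nseq j (\sum_(i < m) t ^+ i.+1 *: y i)) =
    \sum_(a | (deg a < k.+1)%N) t ^+ wt a * F a.
  rewrite (sum_fibers deg); apply: eq_bigr => j _.
  rewrite -[nseq _ _]cats0.
  rewrite (@sml_multinomial _ _ _ Aml k m j (fun i => t ^+ i.+1 *: y i) [::] (leq_ord j)).
  by apply: eq_bigr => a _; rewrite cats0 taylor_term_scale.
have -> : \sum_(s < k.+1) t ^+ s * graded_coef m k s =
    \sum_(a | (wt a < k.+1)%N) t ^+ wt a * F a.
  rewrite (sum_fibers wt); apply: eq_bigr => s _; rewrite mulr_sumr.
  by apply: eq_bigr => a /eqP <-.
have deg_wt a : (deg a <= wt a)%N by apply: leq_sum => i _; rewrite leq_pmull.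
rewrite (bigID (fun a => (wt a < k.+1)%N))/=.
under eq_bigl => a do rewrite (andb_idl (fun h => leq_ltn_trans (deg_wt a) h)).
rewrite [X in X - _]addrC addrK mulr_suml big_mkcond.
apply: le_trans (ler_norm_sum _ _ _) _; apply: ler_sum => a _.
case: ifP => [/andP[_]|_]; last by rewrite normr0 mulr_ge0// exprn_ge0.
rewrite -leqNgt => ka; rewrite normrM ger0_norm ?exprn_ge0// mulrC.
by rewrite ler_wpM2l// ler_wiXn2l.
Qed.

End graded_coefficients.

(** * Expansion along the tangent curve *)

(** Telescoping: the arguments [u + z] are replaced by [u] one at a time, each replacement leaving
    one factor [z] and [j.-1] factors of norm at most [rho]. *)
Lemma sml_nseq_increment (R : realType) (X : normedModType R) (A : seq X -> R)
    (M rho : R) (u z : X) (j : nat) (r : seq X) :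
  symmetric_multilinear A -> (forall s, `|A s| <= M * \prod_(v <- s) `|v|) ->
  0 <= M -> `|u| <= rho -> `|u + z| <= rho ->
  `|A (nseq j (u + z) ++ r) - A (nseq j u ++ r)| <=
    j%:R * M * rho ^+ j.-1 * `|z| * \prod_(v <- r) `|v|.
Proof.
move=> Aml AM M0 urho uzrho; have rho0 : 0 <= rho := le_trans (normr_ge0 u) urho.
elim: j r => [|j IHj] r; first by rewrite subrr normr0 !mul0r.
set P := \prod_(v <- r) `|v|; have P0 : 0 <= P by apply: prodr_ge0.
rewrite /= [in X in X - _]addrC (smlD Aml) -addrA.
have -> : A (u :: nseq j (z + u) ++ r) - A (u :: nseq j u ++ r) =
    A (nseq j (u + z) ++ u :: r) - A (nseq j u ++ u :: r).
  by rewrite !(sml_consC Aml) addrC addrC [z + u]addrC.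
have -> : j.+1%:R * M * rho ^+ j * `|z| * P =
    M * (rho ^+ j * `|z| * P) + j%:R * M * rho ^+ j * `|z| * P.
  by rewrite -natr1; ring.
apply: le_trans (ler_normD _ _) (lerD _ _).
  apply: le_trans (AM _) _; rewrite big_cons big_cat/= -/P big_nseq iter_mulr_1.
  rewrite ler_wpM2l// (mulrC (rho ^+ j)) -!mulrA ler_wpM2l// ler_wpM2r//.
  by rewrite lerXn2r ?nnegrE// addrC.
apply: le_trans (IHj _) _; rewrite big_cons -/P.
(* At [j = 0] the truncated exponent breaks rho^(j-1) rho = rho^j, but the factor [j%:R]
   vanishes. *)
case: j {IHj} => [|j]; first by rewrite !mul0r.
rewrite /= exprSr -!mulrA ler_wpM2l// ler_wpM2l// ler_wpM2l ?exprn_ge0//.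
by rewrite mulrCA ler_wpM2r ?mulr_ge0.
Qed.

Section taylor_form.
Variables (R : realType) (X : normedModType R) (f : X -> R) (k : nat) (x : X).

(* The value [0] above degree [k] makes the family symmetric and multilinear
   without restriction on the number of arguments. *)
Definition taylor_form (s : seq X) : R :=
  if (size s <= k)%N then mlin_app (frechet f (size s) x) s else 0.

Lemma taylor_formE j s : size s = j -> (j <= k)%N ->
  taylor_form s = mlin_app (frechet f j x) s.
Proof. by move=> <- sk; rewrite /taylor_form sk. Qed.

Lemma taylor_form_bound : exists2 M : R, 0 <= M &
  forall s, `|taylor_form s| <= M * \prod_(v <- s) `|v|.
Proof.
exists (\sum_(j < k.+1) `|frechet f j x|) => [|s]; first by rewrite sumr_ge0.
have P0 : 0 <= \prod_(v <- s) `|v| by apply: prodr_ge0.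
have [sk|sk] := leqP (size s) k; last first.
  by rewrite /taylor_form leqNgt sk normr0 mulr_ge0// sumr_ge0.
rewrite (taylor_formE erefl sk) (le_trans (mlin_app_bound _ _))// ler_wpM2r//.
rewrite -ltnS in sk; rewrite (bigD1 (Ordinal sk))//= lerDl.
by rewrite sumr_ge0.
Qed.

Lemma faa_di_brunoE (h : seq X) m s : (s <= k)%N ->
  faa_di_bruno f x h m s = graded_coef taylor_form (nth 0 h) m s s.
Proof.
move=> sk; apply: eq_bigr => a /eqP aw; congr (_ * _).
have sizeE : size (arguments (fun i => a i) (nth 0 h)) = (\sum_(i < m) a i)%N.
  rewrite /arguments size_flatten /shape -map_comp sumnE big_map big_enum /=.
  by apply: eq_bigr => i _; rewrite size_nseq.
(* The degree is at most the weight [s <= k], so the default value of [taylor_form] is not met. *)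
rewrite (taylor_formE sizeE)//; apply: leq_trans sk.
apply: (@leq_trans (weight (fun i => a i))); last by rewrite /weight aw.
by apply: leq_sum => i _; rewrite leq_pmull.
Qed.

Hypothesis fk : kdifferentiable f k x.

Lemma taylor_form_sml : symmetric_multilinear taylor_form.
Proof.
split=> [s s' ss'|a u v s]; last first.
  rewrite /taylor_form /=; case: ifP => sk; last by rewrite mulr0 addr0.
  exact: (mlin_app_linear_head (frechet f (size s).+1 x)).
rewrite /taylor_form -(perm_size ss'); case: ifP => // sk.
(* [kdifferentiable_near] covers the orders strictly between 0 and [k]; order 0 is trivial and order
   [k] is the hypothesis. *)
have [s0|s0] := posnP (size s).
  move/size0nil: s0 ss' => ->; rewrite perm_sym => /perm_nilP -> //.
apply: frechet_sym => //; move: sk; rewrite leq_eqVlt => /predU1P[->//|sk].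
by apply: (nbhs_singleton (kdifferentiable_near fk)); rewrite s0.
Qed.

Lemma kdifferentiable_diff : (0 < k)%N -> differentiable f x.
Proof.
case: fk => fn fx k0; have [k1|k1] := leqP k 1.
  by move: fx; have -> : k.-1 = 0%N by lia.
apply: (nbhs_singleton fn 0%N); lia.
Qed.

Lemma taylor_form1 z : (0 < k)%N -> taylor_form [:: z] = 'd f x z.
Proof.
move=> k0; rewrite (@taylor_formE 1)// -[RHS](@frechetS _ _ f 0)//.
exact: kdifferentiable_diff.
Qed.

Lemma curve_bound (h : k.-1.-tuple X) : exists2 D : R, 0 <= D &
  forall t : R, 0 <= t <= 1 -> `|curve x h t - x| <= D * t.
Proof.
exists (\sum_(i < k.-1) `|h`_i|) => [|t /andP[t0 t1]]; first by rewrite sumr_ge0.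
rewrite /curve addrC addKr (le_trans (ler_norm_sum _ _ _))// mulr_suml ler_sum// => i _.
by rewrite normrZ mulrC ler_wpM2l// ger0_norm ?exprn_ge0// exprS ler_piMr// exprn_ile1.
Qed.

(** Three errors are added: Taylor's remainder at [u t + z] ([b1]), the effect of removing [z] from
    the forms of degree at least 2 ([b2]), and the terms of weight above [k] ([b3]). *)
Lemma taylor_along_curve (h : k.-1.-tuple X) : (2 <= k)%N ->
  (forall s, (1 <= s <= k.-1)%N -> faa_di_bruno f x h s s = 0) ->
  exists2 C : R, 0 <= C & forall e : R, 0 < e -> exists2 d : R, 0 < d &
    forall (t : R) (z : X), 0 < t < d -> `|z| <= t ->
      `|f (curve x h t + z) - f x - 'd f x z - t ^+ k * faa_di_bruno f x h k.-1 k|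
        <= e * t ^+ k + C * t * `|z|.
Proof.
move=> k2 hh; have k0 : (0 < k)%N by exact: ltn_trans k2.
have Aml := taylor_form_sml; have [M M0 AM] := taylor_form_bound.
have [D D0 curveD] := curve_bound h.
have D1 : 0 < D + 1 by rewrite ltr_wpDl.
pose u (t : R) := \sum_(i < k.-1) t ^+ i.+1 *: h`_i.
have [C' C'0 expand] := sml_expansion (nth 0 h) Aml k k.-1.
(* The form of degree [i.+2] changes by a multiple of ((D + 1) t)^(i+1) |z|, and t^(i+1) <= t. *)
pose C : R := \sum_(i < k.-1) i.+2%:R * M * (D + 1) ^+ i.+1.
have C0 : 0 <= C.
  by rewrite sumr_ge0// => i _; rewrite !mulr_ge0// exprn_ge0// ltW.
exists C => // e e0.
have e1 : 0 < e / 2 / (D + 1) ^+ k by rewrite !divr_gt0// exprn_gt0.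
have [d d0 taylor] := taylor_peano k0 fk e1.
(* The three bounds make powers of [t] decrease, keep [u t + z] in the Taylor ball, and absorb C'
   t^(k+1) into (e / 2) t^k. *)
exists (Num.min 1 (Num.min (d / (D + 1)) (e / 2 / (C' + 1)))).
  by rewrite !lt_min ltr01 !divr_gt0// ltr_wpDl.
move=> t z /andP[t0]; rewrite !lt_min => /and3P[t1 td te] zt.
have t0' := ltW t0; have t1' := ltW t1.
have ut : `|u t| <= D * t.
  have t01 : 0 <= t <= 1 by rewrite t0' t1'.
  by have := curveD _ t01; rewrite /curve [X in `|X|]addrC addKr.
pose rho := (D + 1) * t.
have urho : `|u t| <= rho by rewrite (le_trans ut)// /rho mulrDl lerDl mul1r.
have uzrho : `|u t + z| <= rho.
  by rewrite (le_trans (ler_normD _ _))// /rho mulrDl mul1r lerD.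
pose S v : R := \sum_(j < k.+1) j`!%:R^-1 * taylor_form (nseq j v).
have b1 : `|f (curve x h t + z) - S (u t + z)| <= e / 2 * t ^+ k.
  rewrite /curve -addrA.
  have uzd : `|u t + z| < d.
    by rewrite (le_lt_trans uzrho)// /rho mulrC -ltr_pdivlMr.
  have := taylor _ uzd; rewrite (_ : \sum_(j < _) _ = S (u t + z)); last first.
    by apply: eq_bigr => j _; rewrite (@taylor_formE j) ?size_nseq ?leq_ord.
  move/le_trans; apply; rewrite -mulrA ler_pM2l ?divr_gt0//.
  rewrite ler_pdivrMl ?exprn_gt0// -exprMn.
  by rewrite lerXn2r ?nnegrE// (le_trans (normr_ge0 _) urho).
have b2 : `|S (u t + z) - S (u t) - 'd f x z| <= C * t * `|z|.
  have sum_split (G : nat -> R) :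
      \sum_(j < k.+1) G j = G 0%N + (G 1%N + \sum_(i < k.-1) G i.+2).
    by rewrite -[in LHS](prednK k0) 2!big_ord_recl.
  pose G j := j`!%:R^-1 * taylor_form (nseq j (u t + z)) -
    j`!%:R^-1 * taylor_form (nseq j (u t)).
  (* The degree-one increment is exactly the term f'(x) z being subtracted. *)
  have G1 : G 1%N = taylor_form [:: z].
    by rewrite /G invr1 !mul1r /= (smlD Aml) addrC addKr.
  rewrite -(taylor_form1 _ k0) /S -sumrB (sum_split G) G1 /G subrr add0r addrC addKr.
  rewrite /C mulr_suml mulr_suml (le_trans (ler_norm_sum _ _ _))// ler_sum// => i _.
  rewrite -mulrBr normrM.
  have := sml_nseq_increment i.+2 [::] Aml AM M0 urho uzrho.
  rewrite big_nil mulr1 !cats0 /= => incr.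
  apply: (@le_trans _ _ (1 * (i.+2%:R * M * rho ^+ i.+1 * `|z|))).
    rewrite ler_pM// normfV ger0_norm// invf_le1 ?ltr0n ?fact_gt0//.
    by rewrite ler1n fact_gt0.
  rewrite mul1r ler_wpM2r// -!mulrA ler_wpM2l// ler_wpM2l//.
  rewrite /rho exprMn ler_wpM2l ?exprn_ge0 ?(ltW D1)//.
  by rewrite exprS ler_piMr// exprn_ile1.
have b3 : `|S (u t) - f x - t ^+ k * faa_di_bruno f x h k.-1 k| <= e / 2 * t ^+ k.
  have t01 : 0 <= t <= 1 by rewrite t0' t1'.
  have := expand t t01; rewrite -/(S (u t)).
  have -> : \sum_(s < k.+1) t ^+ s * graded_coef taylor_form (nth 0 h) k.-1 k s =
      f x + t ^+ k * faa_di_bruno f x h k.-1 k.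
    rewrite big_ord_recr /= -faa_di_brunoE//; congr (_ + _).
    have sum_split (G : nat -> R) : \sum_(s < k) G s = G 0%N + \sum_(i < k.-1) G i.+1.
      by rewrite -[in LHS](prednK k0) big_ord_recl.
    rewrite (sum_split (fun s => t ^+ s * graded_coef _ _ _ _ s)) mul1r.
    rewrite graded_coef0 (@taylor_formE 0)// big1 ?addr0// => i _.
    have ik : (i.+1 <= k)%N := leq_trans (ltn_ord i) (leq_pred k).
    have im : minn k.-1 i.+1 = minn i.+1 i.+1.
      by rewrite minnn; apply/minn_idPr; exact: ltn_ord.
    rewrite (graded_coef_index _ _ ik (leqnn _) im) -faa_di_brunoE// hh ?mulr0//.
    exact: ltn_ord.
  rewrite opprD addrA; move/le_trans; apply.
  rewrite exprS mulrA ler_wpM2r ?exprn_ge0//.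
  rewrite ltr_pdivlMr ?ltr_wpDl// in te; apply: le_trans (ltW te).
  by rewrite mulrC ler_wpM2l// lerDl.
rewrite [e]splitr mulrDl.
have regroup (a b c p q r : R) : a - p - q - r = (a - b) + (c - p - r) + (b - c - q).
  by ring.
rewrite (regroup _ (S (u t + z)) (S (u t))).
apply: le_trans (ler_normD _ _) _; apply: lerD; last exact: b2.
apply: le_trans (ler_normD _ _) _; apply: lerD; [exact: b1|exact: b3].
Qed.

End taylor_form.

(** * Passage to the limit along tangent sequences *)

Lemma tangent_inequality (R : realType) (X : normedModType R) (Q : set X) (k : nat)
    (f : X -> R) (x : X) (h : k.-1.-tuple X) (t tau : nat -> R) (wn : nat -> X)
    (w : X) (l : R) : (2 <= k)%N ->
  kdifferentiable f k x -> local_minimizer f Q x ->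
  (forall s, (1 <= s <= k.-1)%N -> faa_di_bruno f x h s s = 0) ->
  S0 t -> S0 tau -> U w wn ->
  (forall n, Q (curve x h (t n) + (t n ^+ k.-1 * tau n) *: wn n)) ->
  t n / tau n @[n --> \oo] --> l ->
  0 <= 'd f x w + l * faa_di_bruno f x h k.-1 k.
Proof.
move=> k2 fk [Qx [delta delta0 fmin]] hh [t0 tcvg] [tau0 taucvg] wcvg Qn ttau.
have k0 : (0 < k)%N by exact: ltn_trans k2.
have [C C0 taylor] := taylor_along_curve fk k2 hh.
have [D D0 curveD] := curve_bound x h.
set c := faa_di_bruno _ _ _ _ _.
apply/ler_addgt0Pl => e e0.
have l1 : 0 < `|l| + 1 by rewrite ltr_wpDl.
(* With this choice the error [l * e'] left in the limit is at most [e]. *)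
pose e' := e / (`|l| + 1); have e'0 : 0 < e' by rewrite divr_gt0.
have [d d0 fd] := taylor _ e'0.
(* The term [C * 0 * |w|] is kept as the limit of [C * t n * |wn n|]. *)
suff : 0 <= 'd f x w + l * (c + e') + C * 0 * `|w|.
  rewrite mulr0 mul0r addr0 mulrDr addrA => /le_trans; apply.
  rewrite [leRHS]addrC lerD2l; apply: le_trans (ler_norm _) _.
  rewrite normrM (gtr0_norm e'0) /e' mulrCA ler_piMr ?(ltW e0)//.
  by rewrite ler_pdivrMr// mul1r lerDl.
have dfw : 'd f x (wn n) @[n --> \oo] --> 'd f x w.
  apply: (@cvg_comp _ _ _ wn ('d f x)) wcvg _.
  by have := diff_continuous (kdifferentiable_diff fk k0); apply.
have nw : `|wn n| @[n --> \oo] --> `|w| by apply: cvg_norm.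
have tauw : tau n * `|wn n| @[n --> \oo] --> 0.
  by rewrite -[X in _ --> X](mul0r `|w|); apply: cvgM.
have c1 : t n / tau n * (c + e') @[n --> \oo] --> l * (c + e').
  exact: cvgM ttau (cvg_cst _).
have c2 : C * t n * `|wn n| @[n --> \oo] --> C * 0 * `|w|.
  by apply: cvgM nw; exact: cvgM (cvg_cst _) tcvg.
apply: (cvgr_to_ge (cvgD (cvgD dfw c1) c2)).
have D1 : 0 < D + 1 by rewrite ltr_wpDl.
have near_t (b : R) : 0 < b -> \forall n \near \oo, t n < b.
  by move=> b0; exact: cvgr_lt tcvg _ b0.
near=> n.
have tn0 := t0 n; have taun0 := tau0 n.
have tn1 : t n <= 1 by apply/ltW; near: n; exact: near_t.
have tnd : t n < d by near: n; exact: near_t.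
(* The point of [Q] lies within [(D + 1) * t n] of [x]: [D * t n] for the curve and [t n] for the
   increment. *)
have tndelta : t n < delta / (D + 1) by near: n; apply: near_t; rewrite divr_gt0.
(* This gives an increment of norm at most t^(k-1), hence at most t because [k >= 2]. *)
have tauwn : tau n * `|wn n| < 1 by near: n; exact: cvgr_lt tauw _ ltr01.
set sigma := t n ^+ k.-1 * tau n.
have sigma0 : 0 < sigma by rewrite mulr_gt0// exprn_gt0.
have zt : `|sigma *: wn n| <= t n.
  rewrite normrZ gtr0_norm// -mulrA; apply: (@le_trans _ _ (t n ^+ k.-1)).
    by rewrite ler_piMr ?exprn_ge0 ?(ltW tn0) ?(ltW tauwn).
  rewrite -[leRHS]expr1 ler_wiXn2l ?(ltW tn0)//.
  by rewrite -ltnS (prednK k0).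
have tn01 : 0 <= t n <= 1 by rewrite ltW.
have fx_le : f x <= f (curve x h (t n) + sigma *: wn n).
  apply: fmin; first exact: Qn.
  rewrite addrAC (le_trans (ler_normD _ _))//.
  rewrite ltr_pdivlMr// mulrC mulrDl mul1r in tndelta.
  by apply: le_trans (ltW tndelta); apply: lerD => //; exact: curveD.
have tn0d : 0 < t n < d by rewrite tn0.
have := fd _ _ tn0d zt; rewrite -/c.
have sE : t n ^+ k = sigma * (t n / tau n).
  have -> : t n ^+ k = t n ^+ k.-1 * t n by rewrite -exprSr (prednK k0).
  by rewrite /sigma; field; rewrite gt_eqF.
have zE : 'd f x (sigma *: wn n) = sigma * 'd f x (wn n) by rewrite linearZ.
rewrite normrZ (gtr0_norm sigma0) zE sE => /(le_trans (ler_norm _)).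
(* Multiplied by [sigma], the claim is a sum of two nonnegative quantities: the slack in the
   expansion estimate and the increase of [f] over [f x]. *)
have rearrange (a b p q : R) : sigma * (p + q * (c + e') + C * t n * `|wn n|) =
    (e' * (sigma * q) + C * t n * (sigma * `|wn n|) -
     (a - b - sigma * p - sigma * q * c)) + (a - b) by ring.
rewrite -subr_ge0 => le_e; rewrite -(pmulr_rge0 _ sigma0).
rewrite (rearrange (f (curve x h (t n) + sigma *: wn n)) (f x)).
by rewrite addr_ge0// subr_ge0.
Unshelve. all: by end_near.
Qed.

Theorem theorem1 (R : realType) (X : normedModType R) (Q : set X) (k : nat)
    (f : X -> R) (x : X) (hQ : Q !=set0) (hk : (2 <= k)%N)
    (hf : kdifferentiable f k x) (hmin : local_minimizer f Q x)
    (h : k.-1.-tuple X) (hT : Text k Q x h !=set0)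
    (hh : forall s : nat, (1 <= s <= k.-1)%N -> faa_di_bruno f x h s s = 0) :
  (forall w : X, Tpr k Q x h w -> 0 <= 'd f x w + faa_di_bruno f x h k.-1 k) /\
  (forall w : X, Tinfty k Q x h w -> 0 <= 'd f x w).
Proof.
have k0 : (0 < k)%N by exact: ltn_trans hk.
split=> w [t].
  move=> [wn [t0 ww Qn]]; rewrite -[X in _ + X]mul1r.
  apply: (tangent_inequality hk hf hmin hh t0 t0 ww) => [n|].
    by rewrite -exprSr (prednK k0).
  have -> : (fun n => t n / t n) = cst 1.
    by apply/funext => n; rewrite divff// gt_eqF//; case: t0.
  exact: cvg_cst.
move=> [tau [wn [t0 tau0 ww Qn ttau]]].
have := tangent_inequality (l := 0) hk hf hmin hh t0 tau0 ww Qn.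
rewrite mul0r addr0; apply.
have -> : (fun n => t n / tau n) = (fun n => ((t n)^-1 * tau n)^-1).
  by apply/funext => n; rewrite invfM invrK.
apply: (iffRL (gtr0_cvgV0 _)) ttau; apply: nearW => n.
by case: t0 => t0 _; case: tau0 => tau0 _; rewrite mulr_gt0// invr_gt0.
Qed.
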